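(* Let $G$ be a connected $(P_2+P_3, C_4)$-free graph that contains a $C_6$ as an induced subgraph. Then $G$ has a pair of comparable vertices, or $G$ is the join of $(H+\overline{K_q})$ and a $K_p$, where $H\in \{C_6, F_2\} \cup \mathcal{L} \cup \mathcal{H}_3\cup \mathcal{H}_4 \cup \mathcal{H}_5$, and $p\ge 0$ and $q\ge 0$ are integers.
   Context: All graphs are finite, simple and undirected. $P_t$ and $C_t$ are the chordless path and cycle on $t$ vertices, $K_t$ is the complete graph on $t$ vertices, $\overline{K_t}$ the edgeless graph on $t$ vertices ($K_0$, $\overline{K_0}$ are empty). $G+H$ is the disjoint union; the join $G\vee H$ is obtained from $G+H$ by adding all edges between $V(G)$ and $V(H)$. For a set of graphs $\mathcal{F}$, a graph is $\mathcal{F}$-free if it has no induced subgraph isomorphic to a member of $\mathcal{F}$; ''contains'' means contains as an induced subgraph. Two vertices $x,y$ are comparable if they are nonadjacent and $N(x)\subseteq N(y)$ or $N(y)\subseteq N(x)$, where $N(\cdot)$ is the open neighborhood. Disjoint vertex sets $X,Y$ are complete to each other if every vertex of $X$ is adjacent to every vertex of $Y$. In each definition below, $v_1,\dots,v_6$ are six vertices inducing a $C_6$ with edge set $\{v_1v_2,v_2v_3,v_3v_4,v_4v_5,v_5v_6,v_6v_1\}$. $F_2$: the 9-vertex graph on $\{v_1,\dots,v_6\}$ and three pairwise nonadjacent vertices $s_1,s_2,s_3$, where $s_1$ is adjacent exactly to $v_6,v_1,v_2,v_3$, $s_2$ exactly to $v_2,v_3,v_4,v_5$, and $s_3$ exactly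 to $v_4,v_5,v_6,v_1$. $\mathcal{H}_3$: graphs whose vertex set can be partitioned into $\{v_1,\dots,v_6\}$ and a nonempty clique $X$ such that $X$ is complete to $\{v_1,v_4\}$, and there are no other edges. The theta graph is the graph in $\mathcal{H}_3$ with $|X|=1$. $\mathcal{H}_4$: graphs whose vertex set can be partitioned into $\{v_1,\dots,v_6\}$ and three mutually disjoint cliques $S_1,S_2,S_3$, with $S_1$ nonempty and $S_2,S_3$ possibly empty, such that $S_1$ is complete to $\{v_1,v_2,v_3,v_6\}$, $S_2$ is complete to $\{v_2,v_3,v_4,v_5\}$, $S_3$ is complete to $\{v_1,v_2,v_3,v_4\}$, $S_3$ is complete to $S_1\cup S_2$, and there are no other edges. $\mathcal{H}_5$: graphs whose vertex set can be partitioned into $\{v_1,\dots,v_6\}$ and two disjoint nonempty cliques $S_1,S_2$ such that $S_1$ is complete to $S_2\cup\{v_1,v_2,v_3,v_6\}$, $S_2$ is complete to $\{v_3,v_4,v_5,v_6\}$, and there are no other edges. $\mathcal{L}$: the set of induced subgraphs of the Petersen graph that contain a theta graph. *)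

(* Defs.v *)
From Stdlib Require List.
From mathcomp Require Import all_boot.

Set Implicit Arguments.
Unset Strict Implicit.
Unset Printing Implicit Defensive.

Record sgraph := SGraph {
  vertex :> finType;
  adj : rel vertex;
  adj_sym : symmetric adj;
  adj_irrefl : irreflexive adj }.

Definition isomorphic (G H : sgraph) : Prop :=
  exists2 f : G -> H, bijective f & forall x y, adj (f x) (f y) = adj x y.

Section Induced.
Variables (G : sgraph) (A : {set G}).
Definition induced_adj : rel {x | x \in A} := fun x y => adj (val x) (val y).
Lemma induced_adj_sym : symmetric induced_adj.
Proof. by move=> x y; apply: adj_sym. Qed.
Lemma induced_adj_irrefl : irreflexive induced_adj.
Proof. by move=> x; apply: adj_irrefl. Qed.
Definition induced : sgraph := SGraph induced_adj_sym induced_adj_irrefl.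
End Induced.

(* Containment always means as an induced subgraph. *)
Definition contains (G H : sgraph) : Prop :=
  exists A : {set G}, isomorphic H (induced A).

Definition free (Fs : seq sgraph) (G : sgraph) : Prop :=
  forall F, List.In F Fs -> ~ contains G F.

Definition connected (G : sgraph) : Prop :=
  forall x y : G, connect (@adj G) x y.

Definition nbhd (G : sgraph) (x : G) : {set G} := [set y | adj x y].

(* Every vertex is trivially related to itself, so distinctness is required. *)
Definition comparable_vertices (G : sgraph) (x y : G) : bool :=
  [&& x != y, ~~ adj x y & (nbhd x \subset nbhd y) || (nbhd y \subset nbhd x)].

Definition clique (G : sgraph) (A : {set G}) : Prop :=
  {in A &, forall x y, x != y -> adj x y}.

Definition complete_to (G : sgraph) (A B : {set G}) : Prop :=
  {in A & B, forall x y, adj x y}.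

Definition anticomplete_to (G : sgraph) (A B : {set G}) : Prop :=
  {in A & B, forall x y, ~~ adj x y}.

Section SumJoin.
Variables G H : sgraph.

Definition sum_adj : rel (G + H) := fun x y =>
  match x, y with
  | inl a, inl b => adj a b
  | inr a, inr b => adj a b
  | _, _ => false
  end.
Lemma sum_adj_sym : symmetric sum_adj.
Proof. by move=> [a|a] [b|b] //=; apply: adj_sym. Qed.
Lemma sum_adj_irrefl : irreflexive sum_adj.
Proof. by move=> [a|a] /=; apply: adj_irrefl. Qed.
Definition disjoint_union : sgraph := SGraph sum_adj_sym sum_adj_irrefl.

Definition join_adj : rel (G + H) := fun x y =>
  match x, y with
  | inl a, inl b => adj a b
  | inr a, inr b => adj a b
  | _, _ => true
  end.
Lemma join_adj_sym : symmetric join_adj.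
Proof. by move=> [a|a] [b|b] //=; apply: adj_sym. Qed.
Lemma join_adj_irrefl : irreflexive join_adj.
Proof. by move=> [a|a] /=; apply: adj_irrefl. Qed.
Definition join : sgraph := SGraph join_adj_sym join_adj_irrefl.
End SumJoin.

Section Families.
Variable n : nat.

Definition complete_adj : rel 'I_n := fun i j => i != j.
Lemma complete_adj_sym : symmetric complete_adj.
Proof. by move=> i j; rewrite /complete_adj eq_sym. Qed.
Lemma complete_adj_irrefl : irreflexive complete_adj.
Proof. by move=> i; rewrite /complete_adj eqxx. Qed.
Definition complete_graph : sgraph := SGraph complete_adj_sym complete_adj_irrefl.

Definition edgeless_adj : rel 'I_n := fun _ _ => false.
Lemma edgeless_adj_sym : symmetric edgeless_adj.
Proof. by []. Qed.
Lemma edgeless_adj_irrefl : irreflexive edgeless_adj.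
Proof. by []. Qed.
Definition edgeless_graph : sgraph := SGraph edgeless_adj_sym edgeless_adj_irrefl.

Definition path_adj : rel 'I_n := fun i j => (i.+1 == j) || (j.+1 == i).
Lemma path_adj_sym : symmetric path_adj.
Proof. by move=> i j; rewrite /path_adj orbC. Qed.
Lemma path_adj_irrefl : irreflexive path_adj.
Proof. by move=> i; rewrite /path_adj orbb eqn_leq ltnn. Qed.
Definition path_graph : sgraph := SGraph path_adj_sym path_adj_irrefl.

(* The cycle on n vertices only for 3 <= n. *)
Definition cycle_adj : rel 'I_n := fun i j =>
  (i != j) && ((i.+1 %% n == j) || (j.+1 %% n == i)).
Lemma cycle_adj_sym : symmetric cycle_adj.
Proof. by move=> i j; rewrite /cycle_adj eq_sym orbC. Qed.
Lemma cycle_adj_irrefl : irreflexive cycle_adj.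
Proof. by move=> i; rewrite /cycle_adj eqxx. Qed.
Definition cycle_graph : sgraph := SGraph cycle_adj_sym cycle_adj_irrefl.
End Families.

(* The Petersen graph as the Kneser graph K(5,2). *)
Definition petersen_adj : rel {A : {set 'I_5} | #|A| == 2} :=
  fun A B => [disjoint val A & val B].
Lemma petersen_adj_sym : symmetric petersen_adj.
Proof. by move=> A B; apply: disjoint_sym. Qed.
Lemma petersen_adj_irrefl : irreflexive petersen_adj.
Proof.
move=> A; rewrite /petersen_adj -setI_eq0 setIid.
by apply/negbTE; rewrite -card_gt0 (eqP (valP A)).
Qed.
Definition petersen : sgraph := SGraph petersen_adj_sym petersen_adj_irrefl.

(* Throughout, the hexagon vertex v_k (1 <= k <= 6) is the one of index k - 1
   in 'I_6, and neighbours on the hexagon are listed by their subscripts k. *)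

Definition F2_nbrs (s : 'I_3) : seq nat :=
  nth [::] [:: [:: 6; 1; 2; 3]; [:: 2; 3; 4; 5]; [:: 4; 5; 6; 1]] s.

Definition F2_adj : rel ('I_6 + 'I_3) := fun x y =>
  match x, y with
  | inl i, inl j => cycle_adj i j
  | inl i, inr s | inr s, inl i => i.+1 \in F2_nbrs s
  | inr _, inr _ => false
  end.
Lemma F2_adj_sym : symmetric F2_adj.
Proof. by move=> [i|s] [j|t] //=; apply: cycle_adj_sym. Qed.
Lemma F2_adj_irrefl : irreflexive F2_adj.
Proof. by move=> [i|s] //=; apply: cycle_adj_irrefl. Qed.
Definition F2 : sgraph := SGraph F2_adj_sym F2_adj_irrefl.

Definition hexagon (G : sgraph) (v : 'I_6 -> G) : Prop :=
  injective v /\ forall i j, adj (v i) (v j) = cycle_adj i j.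

Definition hexagon_set (G : sgraph) (v : 'I_6 -> G) : {set G} :=
  [set v i | i : 'I_6].

Definition hexagon_nbrs (G : sgraph) (v : 'I_6 -> G) (S : {set G})
    (ks : seq nat) : Prop :=
  forall x, x \in S -> forall i, adj x (v i) = (i.+1 \in ks).

Definition H3_partition (G : sgraph) (v : 'I_6 -> G) (X : {set G}) : Prop :=
  [/\ hexagon v,
      X = ~: hexagon_set v,
      X != set0 /\ clique X
    & hexagon_nbrs v X [:: 1; 4]].

Definition in_H3 (G : sgraph) : Prop :=
  exists (v : 'I_6 -> G) (X : {set G}), H3_partition v X.

Definition is_theta (G : sgraph) : Prop :=
  exists (v : 'I_6 -> G) (X : {set G}), H3_partition v X /\ #|X| = 1.

Definition in_H4 (G : sgraph) : Prop :=
  exists (v : 'I_6 -> G) (S1 S2 S3 : {set G}),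
  [/\ hexagon v,
      S1 :|: S2 :|: S3 = ~: hexagon_set v
        /\ [/\ [disjoint S1 & S2], [disjoint S1 & S3] & [disjoint S2 & S3]],
      S1 != set0 /\ [/\ clique S1, clique S2 & clique S3],
      [/\ hexagon_nbrs v S1 [:: 1; 2; 3; 6],
          hexagon_nbrs v S2 [:: 2; 3; 4; 5]
        & hexagon_nbrs v S3 [:: 1; 2; 3; 4]]
    & complete_to S3 (S1 :|: S2) /\ anticomplete_to S1 S2].

Definition in_H5 (G : sgraph) : Prop :=
  exists (v : 'I_6 -> G) (S1 S2 : {set G}),
  [/\ hexagon v,
      S1 :|: S2 = ~: hexagon_set v /\ [disjoint S1 & S2],
      [/\ S1 != set0, S2 != set0, clique S1 & clique S2],
      hexagon_nbrs v S1 [:: 1; 2; 3; 6] /\ hexagon_nbrs v S2 [:: 3; 4; 5; 6]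
    & complete_to S1 S2].

Definition in_L (G : sgraph) : Prop :=
  contains petersen G /\ exists2 T : sgraph, is_theta T & contains G T.

(* Main.v *)
(* Split off the clique U of universal vertices and let H = G - U, which has no
   universal vertex and no comparable pair. In H, forbidding C_4 and P_2 + P_3
   leaves four possibilities for the neighbourhood, on a hexagon v_0 ... v_5, of
   a vertex outside it: everything, nothing, an antipodal pair {v_k, v_(k+3)},
   or an arc v_k, ..., v_(k+3). Antipodal pairs and arcs exclude each other.
   - If antipodal pairs occur of one kind only, a vertex seeing nothing is
     dominated by a hexagon vertex, hence does not exist; then a vertex seeing
     everything would be universal, and H lies in H_3.
   - If they occur of several kinds, each kind occurs once, and there is at most
     one vertex off the hexagon, adjacent to all of them: H embeds in the
     Petersen graph.
   - Otherwise all outside vertices see arcs. Adjacency between them depends only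
     on the difference of their positions modulo 6; two opposite positions
     exclude all others (H_5), three alternating ones are single vertices (F_2),
     and what remains is C_6 or in H_4.
   The edgeless part is always empty, i.e. q = 0. *)

Require Import Defs.
From mathcomp Require Import all_boot.

Set Implicit Arguments.
Unset Strict Implicit.
Unset Printing Implicit Defensive.

(** * Isomorphisms and induced embeddings *)

Section Isomorphism.
Implicit Types G H : sgraph.

Lemma isomorphic_sym G H : isomorphic G H -> isomorphic H G.
Proof.
case=> f [g fK gK] f_adj; exists g; first by exists f.
by move=> x y; rewrite -f_adj !gK.
Qed.

Lemma isomorphic_bij G H (f : G -> H) (g : H -> G) :
  cancel f g -> cancel g f -> (forall x y, adj (f x) (f y) = adj x y) ->
  isomorphic G H.
Proof. by move=> fK gK f_adj; exists f => //; exists g. Qed.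

Lemma isomorphic_surj G H (f : G -> H) :
  injective f -> (forall y, exists x, f x = y) ->
  (forall x y, adj (f x) (f y) = adj x y) -> isomorphic G H.
Proof.
move=> f_inj f_surj f_adj; exists f => //.
have f_surjb y : exists x, f x == y by have [x <-] := f_surj y; exists x.
exists (fun y => xchoose (f_surjb y)) => [x|y]; last first.
  exact/eqP/(xchooseP (f_surjb y)).
exact/f_inj/eqP/(xchooseP (f_surjb (f x))).
Qed.

Lemma contains_embedding G H (f : H -> G) :
  injective f -> (forall x y, adj (f x) (f y) = adj x y) -> contains G H.
Proof.
move=> f_inj f_adj; exists [set f x | x : H].
have fP x : f x \in [set f x | x : H] by apply: imset_f.
apply: (@isomorphic_surj _ _ (fun x => exist _ (f x) (fP x) : induced _)).
- by move=> x y [/f_inj].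
- by case=> y yP; have /imsetP[x _ y_def] := yP; exists x; apply: val_inj.
- by move=> x y; rewrite -f_adj.
Qed.

End Isomorphism.

(** * The forbidden subgraphs as conditions on vertices *)

Section Free.
Variable G : sgraph.

Definition C4_free := forall a b c d : G,
  adj a b -> adj b c -> adj c d -> adj d a -> a != c -> b != d ->
  ~~ adj a c -> ~~ adj b d -> False.

(** Only [c != e] must be required: any other two of the five are adjacent, or a third one is
    adjacent to exactly one of them. *)
Definition P2P3_free := forall a b c d e : G,
  adj a b -> adj c d -> adj d e -> c != e -> ~~ adj c e ->
  ~~ adj a c -> ~~ adj a d -> ~~ adj a e ->
  ~~ adj b c -> ~~ adj b d -> ~~ adj b e -> False.

Lemma adj_neq (x y : G) : adj x y -> x != y.
Proof. by apply: contraTneq => ->; rewrite adj_irrefl. Qed.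

Lemma neq_adj (x y z : G) : adj x z -> ~~ adj y z -> x != y.
Proof. by move=> xz; apply: contraNneq => <-. Qed.

Lemma not_contains_C4 : ~ contains G (cycle_graph 4) -> C4_free.
Proof.
move=> noC4 a b c d ab bc cd da a_c b_d nac nbd; apply: noC4.
pose s := [:: a; b; c; d].
have neqs := (adj_neq ab, adj_neq bc, adj_neq cd, adj_neq da).
have s_uniq : uniq s.
  rewrite /= !inE !negb_or a_c b_d neqs /= (eq_sym a d) !neqs //.
pose f (i : cycle_graph 4) := nth a s (i : 'I_4).
apply: (@contains_embedding _ _ f) => [i j /eqP|].
  by rewrite nth_uniq // => /eqP/val_inj.
move=> [[|[|[|[|i]]]] i_lt] [[|[|[|[|j]]]] j_lt] //=;
  rewrite ?adj_irrefl ?ab ?bc ?cd ?da ?(negbTE nac) ?(negbTE nbd) //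
    adj_sym ?ab ?bc ?cd ?da ?(negbTE nac) ?(negbTE nbd) //.
Qed.

Lemma not_contains_P2P3 :
  ~ contains G (disjoint_union (path_graph 2) (path_graph 3)) -> P2P3_free.
Proof.
move=> noP a b c d e ab cd de c_e nce nac nad nae nbc nbd nbe; apply: noP.
have [nca nda nea] : [/\ ~~ adj c a, ~~ adj d a & ~~ adj e a].
  by split; rewrite adj_sym.
have [ncb ndb neb] : [/\ ~~ adj c b, ~~ adj d b & ~~ adj e b].
  by split; rewrite adj_sym.
pose s := [:: a; b; c; d; e].
have s_uniq : uniq s.
  rewrite /= !inE !negb_or c_e (adj_neq ab) (adj_neq cd) (adj_neq de) /=.
  rewrite (neq_adj ab ncb) (neq_adj ab ndb) (neq_adj ab neb) /= andbT.
  by move: ab; rewrite adj_sym => ba; rewrite !(neq_adj ba).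
pose f (i : disjoint_union (path_graph 2) (path_graph 3)) :=
  match i : 'I_2 + 'I_3 with inl i => nth a s i | inr i => nth a s (2 + i) end.
have f_inj : injective f.
  move=> [i|i] [j|j] /eqP; rewrite nth_uniq ?ltn_add2l //=;
    try by rewrite (leq_trans (ltn_ord _)).
  - by move=> /eqP ij; congr inl; apply: val_inj.
  - by move=> /eqP ij; have := ltn_ord i; rewrite ij.
  - by move=> /eqP ij; have := ltn_ord j; rewrite -ij.
  - by rewrite eqn_add2l => /eqP ij; congr inr; apply: val_inj.
apply: (@contains_embedding _ _ f f_inj).
by case=> [] [[|[|[|i]]] i_lt] // [] [[|[|[|j]]] j_lt] //=;
  rewrite ?adj_irrefl // 1?adj_sym ?ab ?cd ?de ?(negbTE nce) ?(negbTE nac)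
    ?(negbTE nad) ?(negbTE nae) ?(negbTE nbc) ?(negbTE nbd) ?(negbTE nbe) //
    adj_sym ?ab ?cd ?de ?(negbTE nce) ?(negbTE nac)
    ?(negbTE nad) ?(negbTE nae) ?(negbTE nbc) ?(negbTE nbd) ?(negbTE nbe).
Qed.

End Free.

(** * Hexagons indexed modulo 6 *)

Definition cyc6 i j := (i.+1 == j %[mod 6]) || (j.+1 == i %[mod 6]).

Lemma cycle_adjE (i j : 'I_6) : cycle_adj i j = cyc6 i j.
Proof.
by case: i j => [[|[|[|[|[|[|//]]]]]] i_lt] [[|[|[|[|[|[|//]]]]]] j_lt].
Qed.

Lemma cyc6_mod i j : cyc6 (i %% 6) (j %% 6) = cyc6 i j.
Proof.
rewrite /cyc6 -[(i %% 6).+1]addn1 -[(j %% 6).+1]addn1.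
by rewrite !modnDml !modn_mod !addn1.
Qed.

(* A hexagon is indexed by all natural numbers, read modulo 6, so that rotations
   are shifts of the index. *)
Definition hex (G : sgraph) (w : nat -> G) :=
  (forall i j, (w i == w j) = (i == j %[mod 6])) /\
  (forall i j, adj (w i) (w j) = cyc6 i j).

Definition shift T k (w : nat -> T) i := w (k + i).

Section Hexagon.
Variable G : sgraph.
Implicit Types (w : nat -> G) (x y z : G) (p : pred nat).

Lemma contains_hex : contains G (cycle_graph 6) -> exists w, hex w.
Proof.
case=> A [f f_bij f_adj].
exists (fun i => val (f (inord (i %% 6)))); split=> i j.
  rewrite (inj_eq val_inj) (inj_eq (bij_inj f_bij)) -(inj_eq val_inj).
  by rewrite /= !inordK ?ltn_mod.
by have := f_adj (inord (i %% 6)) (inord (j %% 6));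
  rewrite /= cycle_adjE !inordK ?ltn_mod // cyc6_mod.
Qed.

Lemma hex_hexagon w : hex w -> hexagon (fun i : 'I_6 => w i).
Proof.
case=> w_eq w_adj; split=> [i j /eqP|i j]; last by rewrite cycle_adjE.
by rewrite w_eq !modn_small ?ltn_ord // => /eqP/val_inj.
Qed.

Lemma hex_shift k w : hex w -> hex (shift k w).
Proof.
case=> w_eq w_adj; split=> i j; rewrite /shift ?w_eq ?w_adj ?eqn_modDl //.
by rewrite /cyc6 -(addnS k i) -(addnS k j) !eqn_modDl.
Qed.

Lemma hex_mod w i : hex w -> w (i %% 6) = w i.
Proof. by case=> w_eq _; apply/eqP; rewrite w_eq modn_mod. Qed.

(* The hexagon, read from position k on, meets the neighbourhood of x as
   prescribed by p. *)
Definition pat w k p x := [forall i : 'I_6, adj x (w (k + i)) == p i].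

Lemma pat_shift j w k p x : pat (shift j w) k p x = pat w (j + k) p x.
Proof. by apply: eq_forallb => i; rewrite /shift addnA. Qed.

Lemma pat_mod w k p x : hex w -> pat w (k %% 6) p x = pat w k p x.
Proof.
move=> hw; apply: eq_forallb => i.
by rewrite -(hex_mod (k %% 6 + i) hw) modnDml hex_mod.
Qed.

(** [i + (6 - k)] stands for i - k modulo 6; the bound on [k] keeps the subtraction from
    truncating. *)
Lemma patP w k p x : hex w -> k <= 6 ->
  reflect (forall i, adj x (w i) = p ((i + (6 - k)) %% 6)) (pat w k p x).
Proof.
move=> hw k_le; apply: (iffP forallP) => [xp i|xp i]; last first.
  by rewrite xp addnAC subnKC // modnDl modn_small ?ltn_ord.
have := xp (Ordinal (ltn_pmod (i + (6 - k)) (isT : 0 < 6))) => /eqP /= <-.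
by rewrite -(hex_mod (k + _) hw) modnDmr addnCA subnKC // modnDr hex_mod.
Qed.

End Hexagon.

Arguments patP {G w k p x}.

Notation full w := (pat w 0 xpredT).
Notation none w := (pat w 0 xpred0).
(** The offsets 0 and 3 form an antipodal pair, so [k < 3] covers all kinds. *)
Notation pair w k := (pat w k (fun i => i %% 3 == 0)).
Notation arc w k := (pat w k (fun i => i < 4)).

Ltac adjacency := solve [ done
  | match goal with
    | H : _ |- _ => first [ by rewrite H | by rewrite adj_sym H ]
    end ].

Ltac separate z :=
  first [ apply: (@neq_adj _ _ _ z); adjacency
        | rewrite eq_sym; apply: (@neq_adj _ _ _ z); adjacency ].

(** Vertices are told apart by a hexagon vertex adjacent to exactly one of them. *)
Ltac distinct := solve [ by rewrite eq_sym
  | match goal with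
    | H : hex ?w |- _ =>
      first [ by rewrite (proj1 H) | separate (w 0) | separate (w 1)
            | separate (w 2) | separate (w 3) | separate (w 4) | separate (w 5) ]
    end ].

Ltac check := first [ adjacency | distinct ].

(** * Adjacencies forced between outside vertices *)

Section Relations.
Variables (G : sgraph) (noC4 : C4_free G) (noP : P2P3_free G) (w : nat -> G).
Hypothesis w_hex : hex w.

Let w_adj := proj2 w_hex.

Ltac C4 a b c d := apply: (@noC4 a b c d); check.
Ltac P2P3 a b c d e := apply: (@noP a b c d e); check.
(** The bound on [k] is settled by computation, hence the case splits on [k] below. The adjacency
    equations stay unnamed because [adjacency] searches the context. *)
Ltac attach :=
  match goal with |- is_true (pat _ ?k _ _) -> _ =>
    move/(patP w_hex (isT : k <= 6)) => ?
  end.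

Lemma C4_fill x : x != w 1 -> adj x (w 0) -> adj x (w 2) -> adj x (w 1).
Proof. by move=> *; apply: contraT => nx1; exfalso; C4 x (w 0) (w 1) (w 2). Qed.

Lemma P2P3_fill x : adj x (w 1) -> adj x (w 3) || adj x (w 4) || adj x (w 5).
Proof.
move=> ?; apply: contraT; rewrite !negb_or => /andP[/andP[? ?] ?]; exfalso.
P2P3 x (w 1) (w 3) (w 4) (w 5).
Qed.

(** Two nonadjacent vertices with two nonadjacent common neighbours lie in a C_4. The same principle
    gives [full_pair], [full_arc] and [pair_clique]. *)
Lemma full_full x y : full w x -> full w y -> x != y -> adj x y.
Proof.
do 2 attach; move=> xy; apply: contraT => nxy; exfalso.
C4 x (w 0) y (w 2).
Qed.

Lemma full_pair k x y : k < 3 -> full w x -> pair w k y -> adj x y.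
Proof.
case: k => [|[|[|//]]] _; do 2 attach; apply: contraT => nxy; exfalso.
- C4 x (w 0) y (w 3).
- C4 x (w 1) y (w 4).
- C4 x (w 2) y (w 5).
Qed.

Lemma full_arc k x y : k < 6 -> full w x -> arc w k y -> adj x y.
Proof.
case: k => [|[|[|[|[|[|//]]]]]] _; do 2 attach;
  apply: contraT => nxy; exfalso.
- C4 x (w 0) y (w 2).
- C4 x (w 1) y (w 3).
- C4 x (w 2) y (w 4).
- C4 x (w 3) y (w 5).
- C4 x (w 4) y (w 0).
- C4 x (w 5) y (w 1).
Qed.

Lemma none_none x y : none w x -> none w y -> ~~ adj x y.
Proof.
by do 2 attach; apply/negP => xy; P2P3 x y (w 0) (w 1) (w 2).
Qed.

(** An edge xy would extend to a path x, y, [w (k + 1)], which is apart from the hexagon edge that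
    the arc misses. *)
Lemma none_arc k x y : k < 6 -> none w x -> arc w k y -> ~~ adj x y.
Proof.
case: k => [|[|[|[|[|[|//]]]]]] _; do 2 attach; apply/negP => xy.
- P2P3 (w 4) (w 5) x y (w 1).
- P2P3 (w 5) (w 0) x y (w 2).
- P2P3 (w 0) (w 1) x y (w 3).
- P2P3 (w 1) (w 2) x y (w 4).
- P2P3 (w 2) (w 3) x y (w 5).
- P2P3 (w 3) (w 4) x y (w 0).
Qed.

Lemma pair_clique k x y : k < 3 -> pair w k x -> pair w k y -> x != y -> adj x y.
Proof.
case: k => [|[|[|//]]] _; do 2 attach; move=> xy;
  apply: contraT => nxy; exfalso.
- C4 x (w 0) y (w 3).
- C4 x (w 1) y (w 4).
- C4 x (w 2) y (w 5).
Qed.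

(** Some hexagon edge joins the two antipodal pairs, and an edge xy would close a C_4 with it. *)
Lemma pair_pair k l x y : k < 3 -> l < 3 -> k != l ->
  pair w k x -> pair w l y -> ~~ adj x y.
Proof.
case: k => [|[|[|//]]] _; case: l => [|[|[|//]]] _ // _; do 2 attach;
  apply/negP => xy.
- C4 x (w 0) (w 1) y.
- C4 x (w 0) (w 5) y.
- C4 x (w 1) (w 0) y.
- C4 x (w 1) (w 2) y.
- C4 x (w 2) (w 3) y.
- C4 x (w 2) (w 1) y.
Qed.

(** If x and y were distinct, they would form an edge apart from the path [w l], z, [w (l + 3)]. *)
Lemma pair_unique k l x y z : k < 3 -> l < 3 -> k != l ->
  pair w k x -> pair w k y -> pair w l z -> x = y.
Proof.
move=> k3 l3 kl px py pz; apply/eqP; apply: contraT => xy; exfalso.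
have nxz := pair_pair k3 l3 kl px pz; have nyz := pair_pair k3 l3 kl py pz.
have {}xy := pair_clique k3 px py xy.
move: px py pz.
case: k k3 kl => [|[|[|//]]] _; case: l l3 => [|[|[|//]]] _ // _;
  do 3 attach.
- P2P3 x y (w 1) z (w 4).
- P2P3 x y (w 2) z (w 5).
- P2P3 x y (w 0) z (w 3).
- P2P3 x y (w 2) z (w 5).
- P2P3 x y (w 0) z (w 3).
- P2P3 x y (w 1) z (w 4).
Qed.

(** If the arc contains both [w 0] and [w 3], then xy is an edge, and a P_3 centred at y is apart
    from a hexagon edge. If it contains only one, then xy is a nonedge, and x with the other end
    forms an edge apart from a P_3 centred at y. *)
Lemma pair_arc k x y : k < 6 -> pair w 0 x -> arc w k y -> False.
Proof.
case: k => [|[|[|[|[|[|//]]]]]] _; do 2 attach.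
- have xy : adj x y by apply: contraT => nxy; exfalso; C4 x (w 0) y (w 3).
  P2P3 (w 4) (w 5) (w 1) y x.
- have xy : ~~ adj x y by apply/negP => xy; C4 x y (w 1) (w 0).
  P2P3 x (w 0) (w 2) y (w 4).
- have xy : ~~ adj x y by apply/negP => xy; C4 x y (w 5) (w 0).
  P2P3 x (w 0) (w 2) y (w 4).
- have xy : adj x y by apply: contraT => nxy; exfalso; C4 x (w 0) y (w 3).
  P2P3 (w 1) (w 2) (w 4) y x.
- have xy : ~~ adj x y by apply/negP => xy; C4 x y (w 4) (w 3).
  P2P3 x (w 3) (w 1) y (w 5).
- have xy : ~~ adj x y by apply/negP => xy; C4 x y (w 2) (w 3).
  P2P3 x (w 3) (w 1) y (w 5).
Qed.

(** At offsets 2 and 4 an edge xy would close a C_4 over a hexagon edge; at the other offsets the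
    arcs share two nonadjacent vertices. *)
Lemma arc_arc0 k x y : k < 6 -> arc w 0 x -> arc w k y -> x != y ->
  adj x y = (k \notin [:: 2; 4]).
Proof.
case: k => [|[|[|[|[|[|//]]]]]] _; do 2 attach; move=> x_y /=;
  (apply: contraT || apply/negbTE/negP) => xy; exfalso.
- C4 x (w 0) y (w 2).
- C4 x (w 1) y (w 3).
- C4 x (w 0) (w 5) y.
- C4 x (w 0) y (w 3).
- C4 x (w 3) (w 4) y.
- C4 x (w 0) y (w 2).
Qed.

(** x and y are adjacent. At any other position, z is adjacent to exactly one of them and shares
    with the other a hexagon vertex that the first misses, which closes a C_4. *)
Lemma arc_arc3 k x y z : k < 6 ->
  arc w 0 x -> arc w 3 y -> arc w k z -> (k == 0) || (k == 3).
Proof.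
case: k => [|[|[|[|[|[|//]]]]]] k6 // ax ay az; exfalso.
all: have x_y : x != y by move: ax ay; do 2 attach; distinct.
all: have x_z : x != z by move: ax az; do 2 attach; distinct.
all: have y_z : y != z by move: ay az; do 2 attach; distinct.
all: have xy := arc_arc0 (isT : 3 < 6) ax ay x_y; have xz := arc_arc0 k6 ax az x_z.
all: move: xy xz ax ay az; rewrite /= => xy xz; do 3 attach.
- have yz : ~~ adj y z by apply/negP => yz; C4 y (w 0) (w 1) z.
  C4 z x y (w 4).
- have yz : adj y z by apply: contraT => nyz; exfalso; C4 y (w 3) z (w 5).
  C4 z y x (w 2).
- have yz : adj y z by apply: contraT => nyz; exfalso; C4 y (w 4) z (w 0).
  C4 z y x (w 1).
- have yz : ~~ adj y z by apply/negP => yz; C4 y (w 3) (w 2) z.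
  C4 z x y (w 5).
Qed.

(** Positions 2 and 4 share [w 4], which position 0 misses, so a second vertex at position 0 would
    give an edge apart from the path z, [w 4], t. *)
Lemma arc_unique_alternating x y z t :
  arc w 0 x -> arc w 0 y -> arc w 2 z -> arc w 4 t -> x = y.
Proof.
move=> ax ay az at_; apply/eqP; apply: contraT => x_y; exfalso.
have xy := arc_arc0 (isT : 0 < 6) ax ay x_y.
move: ax ay az at_; do 4 attach.
have nxz : ~~ adj x z by apply/negP => xz; C4 x (w 0) (w 5) z.
have nyz : ~~ adj y z by apply/negP => yz; C4 y (w 0) (w 5) z.
have nzt : ~~ adj z t by apply/negP => zt; C4 z (w 2) (w 1) t.
have nxt : ~~ adj x t by apply/negP => xt; C4 x (w 3) (w 4) t.
have nyt : ~~ adj y t by apply/negP => yt; C4 y (w 3) (w 4) t.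
P2P3 x y z (w 4) t.
Qed.

(** Otherwise the edge yx is apart from the path [w l], z, [w (l + 3)]. *)
Lemma none_pair k l x y z : k < 3 -> l < 3 -> k != l ->
  none w y -> pair w k x -> pair w l z -> adj y x -> adj y z.
Proof.
move=> k3 l3 kl ny px pz yx; apply: contraT => nyz; exfalso.
have nxz := pair_pair k3 l3 kl px pz; move: ny px pz.
case: k k3 kl => [|[|[|//]]] _; case: l l3 => [|[|[|//]]] _ // _; do 3 attach.
- P2P3 y x (w 1) z (w 4).
- P2P3 y x (w 2) z (w 5).
- P2P3 y x (w 0) z (w 3).
- P2P3 y x (w 2) z (w 5).
- P2P3 y x (w 0) z (w 3).
- P2P3 y x (w 1) z (w 4).
Qed.

End Relations.

(** * The possible neighbourhoods on a hexagon *)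

Section Classification.
Variables (G : sgraph) (noC4 : C4_free G) (noP : P2P3_free G) (w : nat -> G).
Hypothesis w_hex : hex w.

Lemma pat_all k p x : k <= 6 ->
  all (fun i => adj x (w i) == p ((i + (6 - k)) %% 6)) (iota 0 6) ->
  pat w k p x.
Proof.
move=> k6 /allP xp; apply/(patP w_hex k6) => i; rewrite -(hex_mod i w_hex).
rewrite -modnDml; apply/eqP/xp.
by rewrite mem_iota ltn_mod.
Qed.

Variant vertex_spec x : Prop :=
| OnHex i of i < 6 & x = w i
| Full of full w x
| None of none w x
| Pair k of k < 3 & pair w k x
| Arc k of k < 6 & arc w k x.

Lemma vertexP x : vertex_spec x.
Proof.
have [/mapP[i]|x_out] := boolP (x \in [seq w i | i <- iota 0 6]).
  by rewrite mem_iota => *; apply: (OnHex (i := i)).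
have x_neq i : x != w i.
  apply: contraNneq x_out => ->; apply/mapP; exists (i %% 6).
    by rewrite mem_iota ltn_mod.
  by rewrite hex_mod.
pose a i := adj x (w (i %% 6)).
have fill k : a k && a (k + 2) ==> a (k + 1).
  rewrite /a !hex_mod //; apply/implyP => /andP[x0 x2].
  apply: (C4_fill noC4 (hex_shift k w_hex) (x_neq _)) => //.
  by rewrite /shift addn0.
have fill' k : a (k + 1) ==> [|| a (k + 3), a (k + 4) | a (k + 5)].
  rewrite /a !hex_mod //; apply/implyP.
  by move/(P2P3_fill noP (hex_shift k w_hex)); rewrite -orbA.
pose m k p := all (fun i => adj x (w i) == p ((i + (6 - k)) %% 6)) (iota 0 6).
(* Among the 64 subsets of the hexagon, only these patterns satisfy [fill] and [fill'] in all six
   rotations. *)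
have: [|| m 0 xpredT, m 0 xpred0, has (m^~ (fun i => i %% 3 == 0)) (iota 0 3)
        | has (m^~ (fun i => i < 4)) (iota 0 6)].
  move: (fill 0) (fill 1) (fill 2) (fill 3) (fill 4) (fill 5).
  move: (fill' 0) (fill' 1) (fill' 2) (fill' 3) (fill' 4) (fill' 5).
  rewrite /a /m /= => {a fill fill' m}.
  by case: (adj x (w 0)); case: (adj x (w 1)); case: (adj x (w 2));
     case: (adj x (w 3)); case: (adj x (w 4)); case: (adj x (w 5)).
case/or4P => [mx|mx|/hasP[k]|/hasP[k]].
- exact/Full/pat_all.
- exact/None/pat_all.
- by rewrite mem_iota => k3 mx; apply: (Pair k3);
  apply: pat_all mx; case: k k3 => [|[|[|]]].
- by rewrite mem_iota => k6 mx; apply: (Arc k6); apply: pat_all mx; apply: ltnW.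
Qed.

End Classification.

(** * Arcs only: the graphs C_6, F_2, H_4 and H_5 *)

Notation verts w := (fun i : 'I_6 => w (nat_of_ord i)).

Section Families.
Variables (G : sgraph) (noC4 : C4_free G) (noP : P2P3_free G).
Implicit Types (w : nat -> G) (x y z : G).

Lemma pat_rot k w l p x : hex w -> k <= 6 ->
  pat w l p x = pat (shift k w) ((l + (6 - k)) %% 6) p x.
Proof.
move=> w_hex k6; rewrite pat_shift -[RHS]pat_mod // modnDmr addnCA subnKC //.
by rewrite modnDr pat_mod.
Qed.

Lemma arc_shift k w x : hex w -> k <= 6 -> arc w k x -> arc (shift k w) 0 x.
Proof. by move=> w_hex k6; rewrite pat_shift addn0. Qed.

Lemma arc_arc k l w x y : hex w -> k < 6 -> l < 6 ->
  arc w k x -> arc w l y -> x != y ->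
  adj x y = ((l + (6 - k)) %% 6 \notin [:: 2; 4]).
Proof.
move=> w_hex /ltnW k6 l6 /(arc_shift w_hex k6) ax.
rewrite (pat_rot _ _ _ w_hex k6) => ay.
exact: (arc_arc0 noC4 (hex_shift k w_hex) (ltn_pmod _ (isT : 0 < 6)) ax ay).
Qed.

Lemma arc_inj k l w x : hex w -> k < 6 -> l < 6 -> arc w k x -> arc w l x -> k = l.
Proof.
move=> w_hex k6 l6 /(patP w_hex (ltnW k6)) ak /(patP w_hex (ltnW l6)) al.
have kl i : ((i + (6 - k)) %% 6 < 4) = ((i + (6 - l)) %% 6 < 4) by rewrite -ak al.
move: (kl 0) (kl 1) (kl 2) (kl 3) (kl 4) (kl 5) => {ak al kl}.
by case: k k6 => [|[|[|[|[|[|//]]]]]] _; case: l l6 => [|[|[|[|[|[|//]]]]]] _.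
Qed.

Lemma arc_opposite k l w x y z : hex w -> k < 6 -> l < 6 ->
  arc w k x -> arc w ((k + 3) %% 6) y -> arc w l z ->
  l \in [:: k; (k + 3) %% 6].
Proof.
move=> w_hex k6 l6 /(arc_shift w_hex (ltnW k6)) ax.
do 2 rewrite (pat_rot _ _ _ w_hex (ltnW k6)); rewrite modnDml => ay az.
have : (l + (6 - k)) %% 6 \in [:: 0; 3].
  rewrite !inE; apply: (arc_arc3 (y := y) noC4 (hex_shift k w_hex) _ ax _ az).
    exact: ltn_pmod.
  by move: ay; rewrite addnAC subnKC ?(ltnW k6).
by case: k k6 {ax ay az} => [|[|[|[|[|[|//]]]]]] _;
  case: l l6 => [|[|[|[|[|[|//]]]]]] _.
Qed.

Lemma arc_not_hex k w x i : hex w -> k < 6 -> i < 6 -> arc w k x -> x != w i.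
Proof.
move=> w_hex k6 i6 /(patP w_hex (ltnW k6)) ax; apply/negP => /eqP x_wi.
have e j : cyc6 i j = ((j + (6 - k)) %% 6 < 4) by rewrite -ax x_wi (proj2 w_hex).
move: (e 0) (e 1) (e 2) (e 3) (e 4) (e 5) => {ax x_wi e}.
by case: k k6 => [|[|[|[|[|[|//]]]]]] _; case: i i6 => [|[|[|[|[|[|//]]]]]] _.
Qed.

Definition arcs_only w :=
  forall z, (exists2 i, i < 6 & z = w i) \/ (exists2 k, k < 6 & arc w k z).

Lemma arc_out k w x : hex w -> k < 6 -> arc w k x -> x \in ~: hexagon_set (verts w).
Proof.
move=> w_hex k6 ax; rewrite inE; apply/negP => /imsetP[i _ /eqP].
by rewrite (negbTE (arc_not_hex w_hex k6 (ltn_ord i) ax)).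
Qed.

Lemma out_arc w x : arcs_only w -> x \in ~: hexagon_set (verts w) ->
  exists2 k, k < 6 & arc w k x.
Proof.
move=> w_arcs; have [[i i6 ->]|//] := w_arcs x.
by rewrite inE; case/negP; apply/imsetP; exists (Ordinal i6).
Qed.

Lemma arc_set_clique k w : hex w -> k < 6 -> clique [set x | arc w k x].
Proof.
move=> w_hex k6 x y; rewrite !inE => ax ay x_y.
by rewrite (arc_arc w_hex k6 k6 ax ay x_y) subnKC 1?ltnW.
Qed.

Lemma arc_set_disjoint k l w : hex w -> k < 6 -> l < 6 -> k != l ->
  [disjoint [set x | arc w k x] & [set x | arc w l x]].
Proof.
move=> w_hex k6 l6 kl; rewrite -setI_eq0; apply/eqP/setP => x; rewrite !inE.
by apply: contraNF kl => /andP[ax ay]; rewrite (arc_inj w_hex k6 l6 ax ay).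
Qed.

Lemma arc_set_nbrs k w ks : hex w -> k < 6 ->
  (forall i : 'I_6, ((i + (6 - k)) %% 6 < 4) = (i.+1 \in ks)) ->
  hexagon_nbrs (verts w) [set x | arc w k x] ks.
Proof.
move=> w_hex k6 ksP x; rewrite inE => /(patP w_hex (ltnW k6)) ax i.
by rewrite ax ksP.
Qed.

Lemma arc_set_adj k l w x y : hex w -> k < 6 -> l < 6 -> k != l ->
  x \in [set x | arc w k x] -> y \in [set x | arc w l x] ->
  adj x y = ((l + (6 - k)) %% 6 \notin [:: 2; 4]).
Proof.
move=> w_hex k6 l6 kl; rewrite !in_set => ax ay; apply: (arc_arc w_hex k6 l6 ax ay).
by apply: contraNneq kl => xy; apply/eqP/(arc_inj w_hex k6 l6 ax); rewrite xy.
Qed.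

Lemma in_H5_arcs w x y : hex w -> arcs_only w -> arc w 5 x -> arc w 2 y -> in_H5 G.
Proof.
move=> w_hex w_arcs ax ay.
(* v_k has index k - 1, so v_6, v_1, v_2, v_3 is the arc at 5 and v_3, ..., v_6 the arc at 2. These
   positions are opposite, which excludes all others. *)
exists (verts w), [set z | arc w 5 z], [set z | arc w 2 z]; split.
- exact: hex_hexagon.
- split; last exact: arc_set_disjoint.
  apply/setP => z; apply/idP/idP => [|/(out_arc w_arcs)[k k6 az]].
    by case/setUP; rewrite in_set; apply: arc_out.
  have: k \in [:: 2; 5] := arc_opposite w_hex (isT : 2 < 6) k6 ay ax az.
  by rewrite !inE => /orP[] /eqP k_def; move: az; rewrite k_def => ->; rewrite ?orbT.
- split; try exact: arc_set_clique.
  + by apply/set0Pn; exists x; rewrite inE.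
  + by apply/set0Pn; exists y; rewrite inE.
- by split; apply: arc_set_nbrs => // -[[|[|[|[|[|[|//]]]]]]].
- by move=> z t az at_; rewrite (arc_set_adj w_hex _ _ _ az at_).
Qed.

Lemma in_H4_arcs w x : hex w -> arcs_only w -> arc w 5 x ->
  (forall k y, k \in [:: 2; 3; 4] -> ~~ arc w k y) -> in_H4 G.
Proof.
move=> w_hex w_arcs ax no_arc.
(* Position 0 differs by 1 from both 5 and 1, hence [S3] is complete to [S1] and [S2]; positions 5
   and 1 differ by 2, hence [S1] and [S2] are anticomplete. *)
exists (verts w), [set z | arc w 5 z], [set z | arc w 1 z], [set z | arc w 0 z].
split.
- exact: hex_hexagon.
- split; last by split; apply: arc_set_disjoint.
  apply/setP => z; apply/idP/idP => [|/(out_arc w_arcs)[k k6 az]].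
    by case/setUP => [/setUP[]|]; rewrite in_set; apply: arc_out.
  have := no_arc k z; rewrite az; rewrite !inE.
  case: k k6 az => [|[|[|[|[|[|//]]]]]] _ az; rewrite ?az ?orbT // => /(_ isT)//.
- split; first by apply/set0Pn; exists x; rewrite inE.
  by split; apply: arc_set_clique.
- by split; apply: arc_set_nbrs => // -[[|[|[|[|[|[|//]]]]]]].
- split=> z t; last by move=> az at_; rewrite (arc_set_adj w_hex _ _ _ az at_).
  move=> az /setUP[] at_.
  + by rewrite (arc_set_adj w_hex _ _ _ az at_).
  + by rewrite (arc_set_adj w_hex _ _ _ az at_).
Qed.

Lemma isomorphic_C6 w : hex w -> arcs_only w ->
  (forall k x, k < 6 -> ~~ arc w k x) ->
  isomorphic G (cycle_graph 6).
Proof.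
move=> w_hex w_arcs no_arc; apply: isomorphic_sym.
have [v_inj v_adj] := hex_hexagon w_hex.
apply: (@isomorphic_surj (cycle_graph 6) G (verts w)) => // x.
have [[i i6 ->]|[k k6]] := w_arcs x; first by exists (Ordinal i6).
by rewrite (negbTE (no_arc k x k6)).
Qed.

Lemma isomorphic_F2 w x y z : hex w -> arcs_only w ->
  arc w 5 x -> arc w 1 y -> arc w 3 z -> isomorphic G F2.
Proof.
move=> w_hex w_arcs ax ay az; apply: isomorphic_sym.
have [v_inj v_adj] := hex_hexagon w_hex.
pose s (i : nat) := nth x [:: x; y; z] i.
(* The arcs starting at 5, 1, 3 are the neighbourhoods of s_1, s_2, s_3 in F_2. *)
pose r (i : nat) := nth 0 [:: 5; 1; 3] i.
have r6 i : r i < 6 by case: i => [|[|[|[]]]].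
have s_arc (i : 'I_3) : arc w (r i) (s i) by case: i => [[|[|[|[]]]]].
have s_inj : injective (fun i : 'I_3 => s i).
  move=> i j sij; have ai := s_arc i; rewrite sij in ai.
  have {ai sij} := arc_inj w_hex (r6 i) (r6 j) ai (s_arc j).
  case: i j => [[|[|[|//]]] i3] [[|[|[|//]]] j3] // _; exact: val_inj.
pose f (i : F2) : G := match i : 'I_6 + 'I_3 with inl i => w i | inr i => s i end.
have arcE k l t : k < 6 -> l < 6 ->
    arc (shift k w) l t = arc w ((k + l) %% 6) t.
  by move=> k6 l6; rewrite pat_shift pat_mod.
apply: (@isomorphic_surj F2 G f).
- case=> [] i [] j /= ij.
  + by rewrite (v_inj _ _ ij).
  + by move: (arc_not_hex w_hex (r6 j) (ltn_ord i) (s_arc j)); rewrite ij eqxx.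
  + by move: (arc_not_hex w_hex (r6 i) (ltn_ord j) (s_arc i)); rewrite ij eqxx.
  + by rewrite (s_inj _ _ ij).
(* Positions 0, 2, 4 are opposite to the occupied 3, 5, 1, and an opposite pair would exclude the
   remaining occupied positions. Each of 1, 3, 5 holds a single vertex by the alternating
   pattern. *)
- move=> t; have [[i i6 ->]|[k k6 at_]] := w_arcs t.
    by exists (inl (Ordinal i6)).
  case: k k6 at_ => [|[|[|[|[|[|//]]]]]] k6 at_.
  + by have := arc_opposite w_hex k6 (isT : 1 < 6) at_ az ay.
  + exists (inr (Ordinal (isT : 1 < 3))).
    apply: (arc_unique_alternating noC4 noP (hex_shift 1 w_hex) (z := z) (t := x));
      by rewrite arcE.
  + by have := arc_opposite w_hex k6 (isT : 1 < 6) at_ ax ay.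
  + exists (inr (Ordinal (isT : 2 < 3))).
    apply: (arc_unique_alternating noC4 noP (hex_shift 3 w_hex) (z := x) (t := y));
      by rewrite arcE.
  + by have := arc_opposite w_hex k6 (isT : 3 < 6) at_ ay az.
  + exists (inr (Ordinal (isT : 0 < 3))).
    apply: (arc_unique_alternating noC4 noP (hex_shift 5 w_hex) (z := y) (t := z));
      by rewrite arcE.
- have sw (i : 'I_3) (j : 'I_6) : adj (s i) (w j) = (j.+1 \in F2_nbrs i).
    rewrite (elimT (patP w_hex (ltnW (r6 i))) (s_arc i)).
    by case: i j => [[|[|[|//]]] i3] [[|[|[|[|[|[|//]]]]]] j6].
  case=> [] i [] j /=; rewrite ?v_adj // 1?adj_sym ?sw //.
  have [<-|ij] := eqVneq i j; first by rewrite adj_irrefl.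
  rewrite (arc_arc w_hex (r6 _) (r6 _) (s_arc j) (s_arc i)); last first.
    by rewrite (inj_eq s_inj) eq_sym.
  by case: i j ij => [[|[|[|//]]] i3] [[|[|[|//]]] j3].
Qed.

End Families.

(** * The Petersen graph by 2-subsets *)

(* The Kneser vertices receiving v_0, ..., v_5, the vertices attached to the
   antipodal pairs {v_0, v_3}, {v_1, v_4}, {v_2, v_5}, and the vertex off the
   hexagon. *)
Definition duo i :=
  nth (0, 1) [:: (0, 4); (1, 3); (0, 2); (1, 4); (0, 3); (1, 2);
                 (2, 3); (2, 4); (3, 4); (0, 1)] i.

Definition duo_adj i j :=
  [&& (duo i).1 != (duo j).1, (duo i).1 != (duo j).2,
      (duo i).2 != (duo j).1 & (duo i).2 != (duo j).2].

Lemma duo_adj_sym i j : duo_adj i j = duo_adj j i.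
Proof.
rewrite /duo_adj ![(duo j).1 == _]eq_sym ![(duo j).2 == _]eq_sym.
by rewrite [X in _ && X]andbCA.
Qed.

Lemma petersen_duo :
  exists f : nat -> petersen, forall i j, adj (f i) (f j) = duo_adj i j.
Proof.
(* Beyond index 9, [duo] returns its default (0, 1), which is again a valid 2-subset. *)
have duo_lt i : (duo i).1 < (duo i).2 < 5.
  by do 10?[case: i => [//|i]]; rewrite /duo /= nth_default.
pose D i : {set 'I_5} := [set inord (duo i).1; inord (duo i).2].
have lt5 i : ((duo i).1 < 5) * ((duo i).2 < 5).
  by have /andP[lt12 lt2] := duo_lt i; split; rewrite ?(ltn_trans lt12).
have inord_eq (a b : nat) : a < 5 -> b < 5 ->
    (inord a == inord b :> 'I_5) = (a == b).
  by move=> a5 b5; rewrite -(inj_eq val_inj) /= !inordK.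
have D2 i : #|D i| == 2.
  rewrite cards2 inord_eq ?lt5 // neq_ltn.
  by have /andP[-> _] := duo_lt i.
exists (fun i => exist _ (D i) (D2 i)) => i j.
rewrite /= /petersen_adj /= disjoints_subset subUset !sub1set !inE.
by rewrite !inord_eq ?lt5 // !negb_or -!andbA.
Qed.

(** The ten neighbourhoods are pairwise distinct, so a map into the Petersen graph is injective on
    these indices once its adjacencies are known. *)
Lemma duo_adj_inj i j : i < 10 -> j < 10 ->
  (forall k, k < 10 -> duo_adj i k = duo_adj j k) -> i = j.
Proof.
move=> i10 j10 ij; apply/eqP.
have /allP := (isT : all (fun i => all (fun j => (i == j) ||
  ~~ all (fun k => duo_adj i k == duo_adj j k) (iota 0 10)) (iota 0 10))
  (iota 0 10)).
move/(_ i); rewrite mem_iota => /(_ i10)/allP/(_ j); rewrite mem_iota => /(_ j10).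
case/orP=> // /allPn[k]; rewrite mem_iota => k10.
by rewrite ij ?eqxx.
Qed.

(** * Structure without comparable or universal vertices *)

Section Structure.
Variables (G : sgraph) (noC4 : C4_free G) (noP : P2P3_free G).
Implicit Types (w : nat -> G) (x y z : G).

Lemma arcs_only_shift k w : hex w -> k <= 6 -> arcs_only w -> arcs_only (shift k w).
Proof.
move=> w_hex k6 w_arcs z; have [[i _ ->]|[l _ az]] := w_arcs z; [left|right].
  exists ((i + (6 - k)) %% 6); first exact: ltn_pmod.
  rewrite /shift -(hex_mod i w_hex) -(hex_mod (k + _) w_hex) modnDmr addnCA.
  by rewrite subnKC // modnDr.
exists ((l + (6 - k)) %% 6); first exact: ltn_pmod.
by rewrite -pat_rot.
Qed.

Lemma arcs_only_family w : hex w -> arcs_only w ->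
  [\/ isomorphic G (cycle_graph 6), isomorphic G F2, in_H4 G | in_H5 G].
Proof.
move=> w_hex w_arcs; pose t k := [exists x, arc w k x].
have t_shift k l : t ((k + l) %% 6) -> exists x, arc (shift k w) l x.
  by case/existsP=> x; rewrite pat_mod // -pat_shift; exists x.
(* Checked over all 64 sets of occupied positions. Without opposite or alternating positions, a
   nonempty set lies within k + 5, k, k + 1, with k + 5 occupied. *)
have : [|| all (fun k => ~~ t k) (iota 0 6),
           has (fun k => t ((k + 5) %% 6) && t ((k + 2) %% 6)) (iota 0 6),
           has (fun k => [&& t ((k + 5) %% 6), t ((k + 1) %% 6)
             & t ((k + 3) %% 6)]) (iota 0 6)
         | has (fun k => t ((k + 5) %% 6) &&
             all (fun l => ~~ t ((k + l) %% 6)) [:: 2; 3; 4]) (iota 0 6)].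
  rewrite /= {t_shift}.
  by case: (t 0); case: (t 1); case: (t 2); case: (t 3); case: (t 4); case: (t 5).
case/or4P => [/allP t0|/hasP[k]|/hasP[k]|/hasP[k]]; rewrite ?mem_iota.
- constructor 1; apply: (isomorphic_C6 w_hex w_arcs) => k x k6.
  by apply: contra (t0 k _); rewrite ?mem_iota // => ax; apply/existsP; exists x.
- move=> /ltnW k6 /andP[/t_shift[x ax] /t_shift[y ay]].
  constructor 4; apply: (in_H5_arcs noC4 _ _ ax ay); first exact: hex_shift.
  exact: arcs_only_shift.
- move=> /ltnW k6 /and3P[/t_shift[x ax] /t_shift[y ay] /t_shift[z az]].
  constructor 2; apply: (isomorphic_F2 noC4 noP _ _ ax ay az); first exact: hex_shift.
  exact: arcs_only_shift.
- move=> /ltnW k6 /andP[/t_shift[x ax] /allP t0].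
  constructor 3; apply: (in_H4_arcs noC4 _ _ ax); first exact: hex_shift.
    exact: arcs_only_shift.
  move=> l y /t0; apply: contra => ay; apply/existsP; exists y.
  by rewrite pat_mod // -pat_shift.
Qed.

Hypothesis no_comparable : forall x y, x != y -> ~~ adj x y ->
  ~ (forall z, adj x z -> adj y z).
Hypothesis no_universal : forall x, ~ (forall z, z != x -> adj x z).

Lemma full_adj w x z : hex w -> full w x -> ~~ none w z -> z != x -> adj x z.
Proof.
move=> w_hex fx nz; rewrite eq_sym.
have [i _ ->|fz|/(negP nz)//|k k3 pz|k k6 az] := vertexP noC4 noP w_hex z => x_z.
- by rewrite (elimT (patP w_hex (isT : 0 <= 6)) fx).
- exact: (full_full noC4 w_hex fx fz).
- exact: (full_pair noC4 w_hex k3 fx pz).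
- exact: (full_arc noC4 w_hex k6 fx az).
Qed.

Lemma none_adj w y z : hex w -> none w y -> adj y z ->
  full w z \/ exists2 k, k < 3 & pair w k z.
Proof.
move=> w_hex ny yz.
have [i _ z_wi|fz|nz|k k3 pz|k k6 az] := vertexP noC4 noP w_hex z.
- by move: yz; rewrite z_wi (elimT (patP w_hex (isT : 0 <= 6)) ny).
- by left.
- by move: (none_none noP w_hex ny nz); rewrite yz.
- by right; exists k.
- by move: (none_arc noP w_hex k6 ny az); rewrite yz.
Qed.

Lemma none_neq w y i : hex w -> none w y -> y != w i /\ ~~ adj y (w i).
Proof.
move=> w_hex /(patP w_hex (isT : 0 <= 6)) ny; rewrite ny; split=> //.
apply/eqP => y_wi; have := ny (i + 1); rewrite y_wi (proj2 w_hex).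
by rewrite /cyc6 addn1 eqxx.
Qed.

(** All neighbours of y are full or attached to the pair [k], hence adjacent to [w k], which would
    be comparable to y. The case without any pair is included. *)
Lemma no_none w k : hex w -> k < 3 -> (forall l x, l < 3 -> pair w l x -> l = k) ->
  forall y, ~~ none w y.
Proof.
move=> w_hex k3 one_pair y; apply/negP => ny.
have [y_wk nywk] := none_neq k w_hex ny.
apply: (no_comparable y_wk nywk) => z /(none_adj w_hex ny) [fz|[l l3 pz]].
  by rewrite adj_sym (elimT (patP w_hex (isT : 0 <= 6)) fz).
have k6 : k <= 6 by apply: leq_trans (ltnW k3) _.
have l_k := one_pair l z l3 pz; rewrite l_k in pz.
by rewrite adj_sym (elimT (patP w_hex k6) pz) subnKC.
Qed.

Lemma no_full w : hex w -> (forall y, ~~ none w y) -> forall x, ~~ full w x.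
Proof.
move=> w_hex n0 x; apply/negP => fx; apply: (@no_universal x) => z z_x.
exact: full_adj fx (n0 z) z_x.
Qed.

Lemma pair_not_hex k w x i : hex w -> k < 3 -> i < 6 -> pair w k x -> x != w i.
Proof.
move=> w_hex k3 i6 px; apply/negP => /eqP x_wi.
have {px}/(patP w_hex (leq_trans (ltnW k3) (isT : 3 <= 6))) px := px.
have e j : cyc6 i j = ((j + (6 - k)) %% 6 %% 3 == 0).
  by rewrite -px x_wi (proj2 w_hex).
move: (e 0) (e 1) (e 2) (e 3) (e 4) (e 5) => {px x_wi e}.
by case: k k3 => [|[|[|//]]] _; case: i i6 => [|[|[|[|[|[|//]]]]]] _.
Qed.

Lemma pair_inj k l w x : hex w -> k < 3 -> l < 3 ->
  pair w k x -> pair w l x -> k = l.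
Proof.
move=> w_hex k3 l3 pk pl; have le6 m : m < 3 -> m <= 6 by move/ltnW/leq_trans->.
have kl i : ((i + (6 - k)) %% 6 %% 3 == 0) = ((i + (6 - l)) %% 6 %% 3 == 0).
  by rewrite -(elimT (patP w_hex (le6 k k3)) pk) (elimT (patP w_hex (le6 l l3)) pl).
move: (kl 0) (kl 1) (kl 2) => {pk pl kl}.
by case: k k3 => [|[|[|//]]] _; case: l l3 => [|[|[|//]]] _.
Qed.

Lemma in_H3_pairs w x : hex w -> pair w 0 x ->
  (forall l y, l < 3 -> pair w l y -> l = 0) -> in_H3 G.
Proof.
move=> w_hex px one_pair; have n0 := no_none w_hex (isT : 0 < 3) one_pair.
have f0 := no_full w_hex n0.
have outP z : z \in ~: hexagon_set (verts w) -> pair w 0 z.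
  have [i i6 ->|fz|nz|k k3 pz|k k6 az] := vertexP noC4 noP w_hex z => z_out.
  - by case/setCP: z_out; apply/imsetP; exists (Ordinal i6).
  - by case/negP: (f0 z).
  - by case/negP: (n0 z).
  - by have k0 := one_pair k z k3 pz; rewrite k0 in pz.
  - by case: (pair_arc noC4 noP w_hex k6 px az).
exists (verts w), (~: hexagon_set (verts w)); split=> //.
- exact: hex_hexagon.
- split; last by move=> y z /outP py /outP pz; apply: (pair_clique noC4 w_hex) py pz.
  apply/set0Pn; exists x; apply/setCP => /imsetP[i _ /eqP].
  by rewrite (negbTE (pair_not_hex w_hex _ _ px)).
- move=> y /outP/(patP w_hex (isT : 0 <= 6)) py i; rewrite py.
  by case: i => [[|[|[|[|[|[|//]]]]]]].
Qed.

Lemma contains_theta w x : hex w -> pair w 0 x ->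
  exists2 T : sgraph, is_theta T & contains G T.
Proof.
move=> w_hex px; pose B := x |: hexagon_set (verts w).
have xB : x \in B by rewrite !inE eqxx.
have wB (i : 'I_6) : w i \in B.
  by apply/setUP; right; apply/imsetP; exists i.
have [v_inj v_adj] := hex_hexagon w_hex.
exists (induced B); last by exists B; apply: (@isomorphic_bij _ _ id id).
pose v (i : 'I_6) : induced B := exist _ (w i) (wB i).
pose x' : induced B := exist _ x xB.
exists v, [set x']; split; last by rewrite cards1.
split.
- by split=> [i j /(congr1 val)/v_inj//|i j]; apply: v_adj.
- apply/setP => -[z zB]; rewrite !inE -(inj_eq val_inj) /=.
  apply/eqP/negP => [z_x /imsetP[i _ /(congr1 val) /= /eqP]|z_out].
    rewrite z_x.
    by rewrite (negbTE (pair_not_hex w_hex _ _ px)).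
  case/setU1P: (zB) => // /imsetP[i _ z_wi]; case: z_out.
  by apply/imsetP; exists i => //; apply: val_inj.
- split; first by apply/set0Pn; exists x'; rewrite inE.
  by move=> y z; rewrite !inE => /eqP-> /eqP->; rewrite eqxx.
- move=> y; rewrite inE => /eqP-> i.
  rewrite [LHS](elimT (patP w_hex (isT : 0 <= 6)) px).
  by case: i => [[|[|[|[|[|[|//]]]]]]].
Qed.

(** The numbering is that of [duo]. *)
Definition petersen_class w i z :=
  if i < 6 then z == w i else if i < 9 then pair w (i - 6) z else none w z.

(** * Several kinds of antipodal pairs: the Petersen case *)

Section TwoPairClasses.
Variables (w : nat -> G) (x0 x1 : G) (k1 : nat).
Hypotheses (w_hex : hex w) (px0 : pair w 0 x0).
Hypotheses (k1_gt0 : 0 < k1) (k1_lt3 : k1 < 3) (px1 : pair w k1 x1).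

Lemma other_class l : exists m z, [/\ m < 3, m != l & pair w m z].
Proof.
have [->|l_neq0] := eqVneq l 0; first by exists k1, x1; rewrite -lt0n.
by exists 0, x0; rewrite eq_sym.
Qed.

Lemma class_unique k x y : k < 3 -> pair w k x -> pair w k y -> x = y.
Proof.
move=> k3 px py; have [m [z [m3 mk pz]]] := other_class k.
by apply: (pair_unique noC4 noP w_hex k3 m3 _ px py pz); rewrite eq_sym.
Qed.

(** If all neighbours of y were full, [w 0] would dominate y. So y is adjacent to a vertex of some
    pair, and [none_pair] carries adjacency to the other kinds. *)
Lemma none_pair_adj y k x : k < 3 -> none w y -> pair w k x -> adj y x.
Proof.
move=> k3 ny px.
have [l [z [l3 pz yz]]] : exists l z, [/\ l < 3, pair w l z & adj y z].
  have [y_w0 nyw0] := none_neq 0 w_hex ny.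
  have [/existsP[z /andP[yz nfz]]|all_full] :=
      boolP [exists z, adj y z && ~~ full w z].
    have [fz|[l l3 pz]] := none_adj w_hex ny yz; first by rewrite fz in nfz.
    by exists l, z.
  case: (no_comparable y_w0 nyw0) => z yz; rewrite adj_sym.
  have fz : full w z.
    by apply: contraNT all_full => nfz; apply/existsP; exists z; rewrite yz.
  by rewrite (elimT (patP w_hex (isT : 0 <= 6)) fz).
have spread a b s t : a < 3 -> b < 3 -> pair w a s -> pair w b t -> a != b ->
    adj y s -> adj y t.
  by move=> a3 b3 ps pt ab; apply: (none_pair noC4 noP w_hex a3 b3 ab ny ps pt).
(* For [l = k], adjacency reaches x by way of a vertex of another kind. *)
have [lk|] := eqVneq l k; last by move=> lk; apply: spread pz px lk yz.
have [m [t [m3 mk pt]]] := other_class k.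
have yt : adj y t by apply: spread pz pt _ yz; rewrite // lk eq_sym.
exact: spread pt px mk yt.
Qed.

Lemma nadj_x0_x1 : ~~ adj x0 x1.
Proof.
by apply: (pair_pair noC4 w_hex _ k1_lt3 _ px0 px1); rewrite // neq_ltn k1_gt0.
Qed.

Lemma x0_neq_x1 : x0 != x1.
Proof.
apply: contraTneq k1_gt0 => x01; have px1' := px1; rewrite -x01 in px1'.
by rewrite -(pair_inj w_hex (isT : 0 < 3) k1_lt3 px0 px1').
Qed.

(** Both are adjacent to the nonadjacent [x0] and [x1], which would give a C_4. *)
Lemma none_unique y z : none w y -> none w z -> y = z.
Proof.
move=> ny nz; apply/eqP; apply: contraT => y_z.
have y0 := none_pair_adj (isT : 0 < 3) ny px0.
have y1 := none_pair_adj k1_lt3 ny px1.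
have z0 := none_pair_adj (isT : 0 < 3) nz px0.
have z1 := none_pair_adj k1_lt3 nz px1.
exfalso; apply: (@noC4 y x0 z x1 _ _ _ _ y_z x0_neq_x1 _ nadj_x0_x1);
  rewrite // 1?adj_sym //.
exact: (none_none noP w_hex nz ny).
Qed.

(** A full vertex shares [x0] and [x1] with every vertex off the hexagon, so C_4-freeness makes it
    adjacent to those too, hence universal. *)
Lemma pair_no_full x : ~~ full w x.
Proof.
apply/negP => fx; apply: (@no_universal x) => z z_x.
have [nz|] := boolP (none w z); last by move=> nz; apply: full_adj fx nz z_x.
have y0 := none_pair_adj (isT : 0 < 3) nz px0.
have y1 := none_pair_adj k1_lt3 nz px1.
have xx0 := full_pair noC4 w_hex (isT : 0 < 3) fx px0.
have xx1 := full_pair noC4 w_hex k1_lt3 fx px1.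
apply: contraT => nxz; exfalso.
by apply: (@noC4 x x0 z x1 _ _ _ _ _ x0_neq_x1 nxz nadj_x0_x1);
  rewrite // 1?eq_sym // adj_sym.
Qed.

Lemma petersen_class_ex z : exists2 i, i < 10 & petersen_class w i z.
Proof.
have [i i6 ->|fz|nz|k k3 pz|k k6 az] := vertexP noC4 noP w_hex z.
- by exists i; rewrite /petersen_class ?i6 // (ltn_trans i6).
- by case/negP: (pair_no_full z).
- by exists 9.
- exists (k + 6); first by rewrite -(ltn_add2r 6) in k3; apply: ltn_trans k3 _.
  by rewrite /petersen_class ltnNge leq_addl /= -[9]/(3 + 6) ltn_add2r k3 addnK.
- by case: (pair_arc noC4 noP w_hex k6 px0 az).
Qed.

Lemma petersen_class_inj i y z :
  petersen_class w i y -> petersen_class w i z -> y = z.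
Proof.
rewrite /petersen_class; case: ltnP => [_ /eqP-> /eqP->//|i6].
case: ltnP => [i9|_]; last exact: none_unique.
by apply: class_unique; rewrite ltn_subLR.
Qed.

Lemma petersen_class_adj i j y z : i < 10 -> j < 10 ->
  petersen_class w i y -> petersen_class w j z -> adj y z = duo_adj i j.
Proof.
wlog ij : i j y z / i <= j.
  move=> adj_ij i10 j10 yi zj; have [ij|/ltnW ji] := leqP i j; first exact: adj_ij.
  by rewrite adj_sym duo_adj_sym; apply: adj_ij.
move=> i10 j10.
have hexadj := proj2 w_hex.
have [<- yi zi|] := eqVneq i j.
  by rewrite (petersen_class_inj yi zi) adj_irrefl /duo_adj eqxx.
move=> i_j; rewrite /petersen_class.
case: ltnP => [i6 /eqP->|i6]; case: (ltnP j 6) => j6.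
- move/eqP->; rewrite hexadj; move: i6 j6 {ij i_j i10 j10}.
  by case: i => [|[|[|[|[|[|//]]]]]]; case: j => [|[|[|[|[|[|//]]]]]].
- case: ifP => j9.
    move/(patP w_hex) => pz; rewrite adj_sym pz; last first.
      by rewrite leq_subLR (leq_trans (ltnW j9)).
    by move: i6 j6 j9 {pz ij i_j i10 j10}; case: i => [|[|[|[|[|[|//]]]]]];
      do 9?[case: j => [|j] //].
  move/(patP w_hex (isT : 0 <= 6)) => nz; rewrite adj_sym nz.
  have -> : j = 9 by apply/eqP; rewrite eqn_leq -ltnS j10 leqNgt j9.
  by move: i6 {ij i_j i10}; case: i => [|[|[|[|[|[|//]]]]]].
- by rewrite ltnNge (leq_trans i6 ij) in j6.
- case: ifP => i9; case: ifP => j9.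
  + move=> py pz; rewrite (negbTE (pair_pair noC4 w_hex _ _ _ py pz)) ?ltn_subLR //.
      by move: i6 i9 j6 j9 ij i_j {py pz i10 j10}; do 9?[case: i => [|i] //];
      do 9?[case: j => [|j] //].
    by apply: contra i_j => /eqP eij; rewrite -(subnK i6) -(subnK j6) eij.
  + have -> : j = 9 by apply/eqP; rewrite eqn_leq -ltnS j10 leqNgt j9.
    move=> py nz; rewrite adj_sym (none_pair_adj _ nz py) ?ltn_subLR //.
    by move: i6 i9 {ij i_j i10 py}; do 9?[case: i => [|i] //].
  + by rewrite (leq_ltn_trans ij j9) in i9.
  + move=> _ _; case/negP: i_j; apply/eqP/anti_leq; rewrite ij /=.
    by rewrite (leq_trans _ (_ : 9 <= i)) // leqNgt i9.
Qed.

Lemma in_L_pairs : in_L G.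
Proof.
split; last exact: contains_theta px0.
have classP z : exists i, (i < 10) && petersen_class w i z.
  by have [i i10 zi] := petersen_class_ex z; exists i; rewrite i10.
pose c z := xchoose (classP z).
have [c10 cP] : (forall z, c z < 10) /\ (forall z, petersen_class w (c z) z).
  by split=> z; have /andP[] := xchooseP (classP z).
have [f f_adj] := petersen_duo.
have fc_adj y z : adj (f (c y)) (f (c z)) = adj y z.
  by rewrite f_adj (petersen_class_adj (c10 y) (c10 z)).
have f_inj i j : i < 10 -> j < 10 -> f i = f j -> i = j.
  by move=> i10 j10 fij; apply: duo_adj_inj => // k _; rewrite -!f_adj fij.
apply: (@contains_embedding _ _ (fun z => f (c z))) => // y z.
move/(f_inj _ _ (c10 y) (c10 z)) => cyz.
by apply: (petersen_class_inj (cP y)); rewrite cyz.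
Qed.

End TwoPairClasses.

(** * The case distinction on antipodal pairs *)

Lemma hexagonal_structure w : hex w ->
  isomorphic G (cycle_graph 6) \/ isomorphic G F2 \/ in_L G
      \/ in_H3 G \/ in_H4 G \/ in_H5 G.
Proof.
move=> w_hex.
have [/existsP[k /existsP[x px]]|no_pair] :=
    boolP [exists k : 'I_3, [exists x, pair w k x]].
  (* The hexagon is rotated so that the given pair is at position 0. *)
  have {}px : pair (shift k w) 0 x by rewrite pat_shift addn0.
  have {}w_hex := hex_shift k w_hex.
  move: (shift k w) w_hex px => {}w w_hex px.
  have [/existsP[l /andP[l0 /existsP[y py]]]|one_pair] :=
      boolP [exists l : 'I_3, (0 < l) && [exists y, pair w l y]].
    by right; right; left; apply: (in_L_pairs w_hex px l0 _ py).
  right; right; right; left; apply: (in_H3_pairs w_hex px) => l y l3 py.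
  apply/eqP; apply: contraNT one_pair; rewrite -lt0n => l0.
  by apply/existsP; exists (Ordinal l3); rewrite l0; apply/existsP; exists y.
have n_pair l y : l < 3 -> ~~ pair w l y.
  move=> l3; apply: contra no_pair => py; apply/existsP; exists (Ordinal l3).
  by apply/existsP; exists y.
have n0 : forall y, ~~ none w y.
  by apply: (no_none w_hex (isT : 0 < 3)) => l y l3; rewrite (negbTE (n_pair l y l3)).
have f0 := no_full w_hex n0.
have w_arcs : arcs_only w.
  move=> z; have [i i6 ->|fz|nz|k k3 pz|k k6 az] := vertexP noC4 noP w_hex z.
  - by left; exists i.
  - by case/negP: (f0 z).
  - by case/negP: (n0 z).
  - by case/negP: (n_pair k z k3).
  - by right; exists k.
by have [|||] := arcs_only_family w_hex w_arcs; tauto.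
Qed.

End Structure.

(** * Splitting off the universal vertices *)

Lemma isomorphic_join (G : sgraph) (U : {set G}) :
  clique U -> complete_to U (~: U) ->
  isomorphic G (join (disjoint_union (induced (~: U)) (edgeless_graph 0))
                     (complete_graph #|U|)).
Proof.
move=> U_clique U_compl; apply: isomorphic_sym.
pose J := join (disjoint_union (induced (~: U)) (edgeless_graph 0))
               (complete_graph #|U|).
pose f (x : J) : G := match x : (_ + 'I_0) + 'I_#|U| with
  | inl (inl z) => val z
  | inl (inr i) => let: Ordinal _ i_lt0 := i in match notF i_lt0 with end
  | inr i => enum_val i
  end.
have UC (i : 'I_#|U|) (z : induced (~: U)) : adj (enum_val i) (val z).
  exact: U_compl (enum_valP i) (valP z).
have f_adj (x y : J) : adj (f x) (f y) = adj x y.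
  case: x => [[z|[]//]|i]; case: y => [[t|[]//]|j] //=.
  - by rewrite adj_sym UC.
  - by rewrite UC.
  - rewrite /complete_adj; have [->|ij] := eqVneq i j; first exact: adj_irrefl.
    by rewrite U_clique ?enum_valP // (inj_eq enum_val_inj).
apply: (isomorphic_surj (f := f)) => //.
- case=> [[z|[]//]|i] [[t|[]//]|j] /= fxy.
  + by congr (inl (inl _)); apply: val_inj.
  + by have := UC j z; rewrite -fxy adj_irrefl.
  + by have := UC i t; rewrite fxy adj_irrefl.
  + by congr inr; apply: enum_val_inj.
- move=> y; have [yU|yU] := boolP (y \in U).
    by exists (inr (enum_rank_in yU y)); apply: enum_rankK_in.
  have yC : y \in ~: U by rewrite inE.
  by exists (inl (inl (exist _ y yC))).
Qed.

Theorem theorem2 (G : sgraph)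
    (G_conn : connected G)
    (G_free : free [:: disjoint_union (path_graph 2) (path_graph 3);
                       cycle_graph 4] G)
    (G_C6 : contains G (cycle_graph 6)) :
  (exists x y : G, comparable_vertices x y) \/
  (exists (H : sgraph) (p q : nat),
     (isomorphic H (cycle_graph 6) \/ isomorphic H F2 \/ in_L H
      \/ in_H3 H \/ in_H4 H \/ in_H5 H) /\
     isomorphic G
       (join (disjoint_union H (edgeless_graph q)) (complete_graph p))).
Proof.
have noP : P2P3_free G by apply: not_contains_P2P3; apply: G_free; left.
have noC4 : C4_free G by apply: not_contains_C4; apply: G_free; right; left.
have [w w_hex] := contains_hex G_C6.
have [/existsP[x /existsP[y xy]]|no_comp] :=
  boolP [exists x : G, [exists y, comparable_vertices x y]].
  by left; exists x, y.
right; pose U := [set x : G | [forall y, (y != x) ==> adj x y]].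
have U_adj x y : x \in U -> y != x -> adj x y.
  by rewrite inE => /forallP/(_ y)/implyP.
pose H := induced (~: U).
exists H, #|U|, 0; split; last first.
  apply: isomorphic_join => x y xU; first by rewrite eq_sym => _; apply: U_adj.
  by rewrite inE => yU; apply: U_adj => //; apply: contraNneq yU => ->.
have wU i : w i \in ~: U.
  (* [w i] is not universal because it misses [w (i + 2)]. *)
  have [/(_ 2 0) w_eq /(_ 0 2)] := hex_shift i w_hex.
  rewrite /shift addn0 in w_eq *; rewrite inE => w_adj; apply/negP => wiU.
  by rewrite U_adj ?w_eq in w_adj.
pose v i : H := exist _ (w i) (wU i).
have v_hex : hex v.
  by case: w_hex => w_eq w_adj; split=> i j; [apply: w_eq|apply: w_adj].
apply: (hexagonal_structure _ _ _ _ v_hex).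
- by move=> a b c d; apply: noC4.
- by move=> a b c d e; apply: noP.
(* A comparable pair of [H] stays comparable in [G], since the removed vertices are adjacent to
   both. *)
- move=> x y x_y nxy xy; case/negP: no_comp.
  apply/existsP; exists (val x); apply/existsP; exists (val y).
  rewrite /comparable_vertices (inj_eq val_inj); apply/and3P; split=> //.
  apply/orP; left; apply/subsetP => z; rewrite !inE => xz.
  have [zU|zU] := boolP (z \in U); last first.
    have zC : z \in ~: U by rewrite inE.
    exact: (xy (exist _ z zC)).
  rewrite adj_sym U_adj //.
  by apply: contraTneq zU => <-; move: (valP y); rewrite inE.
(* A universal vertex of [H] would be universal in [G], hence in [U]. *)
- move=> x x_adj; move: (valP x); rewrite inE => /negP[]; rewrite inE.
  apply/forallP => y; apply/implyP => y_x.
  have [yU|yU] := boolP (y \in U); first by rewrite adj_sym U_adj // eq_sym.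
  have yC : y \in ~: U by rewrite inE.
  by apply: (x_adj (exist _ y yC)); rewrite -(inj_eq val_inj).
Qed.
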